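(* Let $\operatorname{num}\in\{\operatorname{Lev}^1,\operatorname{Lev}^2,\operatorname{bas}\}$ and let $(P_i:\underline{X}_i\to\underline{Y}_i)_{i\in I}$ be a set-indexed family of problems. Then $\operatorname{num}(\lceil P_i\rceil_{i\in I})=\sup\{\operatorname{num}(P_i)\mid i\in I\}$.
   Context: A problem $P:\underline{X}\to\underline{Y}$ is a set of partial functions from $\underline{X}$ to $\underline{Y}$; a partial function is treated as a function on its domain with the subspace topology. For a function $f:\underline{X}\to\underline{Y}$: $\mathcal{L}^1_0(f)=\mathcal{L}^2_0(f)=X$; $\mathcal{L}^1_{\alpha+1}(f)=\{x\in\mathcal{L}^1_\alpha(f)\mid f|_{\mathcal{L}^1_\alpha(f)}\text{ discontinuous at }x\}$, $\mathcal{L}^1_\gamma(f)=\bigcap_{\alpha<\gamma}\mathcal{L}^1_\alpha(f)$ for limit $\gamma$; $\mathcal{L}^2_{\alpha+1}(f)=cl\{x\in\mathcal{L}^2_\alpha(f)\mid f|_{\mathcal{L}^2_\alpha(f)}\text{ discontinuous at }x\}$, $\mathcal{L}^2_\gamma(f)=cl\bigcap_{\alpha<\gamma}\mathcal{L}^2_\alpha(f)$ for limit $\gamma$. $\operatorname{Lev}^i(f)=\min\{\alpha\mid\mathcal{L}^i_\alpha(f)=\emptyset\}$, a non-existing Level being regarded as greater than all ordinals. A partition for $f$ is a partition $p$ of its domain with $f|_U$ continuous for all $U\in p$; $\operatorname{bas}(f)$ is the least cardinality of such a partition. For a problem $P$, $\operatorname{num}(P)=\min\{\operatorname{num}(f)\mid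 f\in P\}$. The coproduct $\coprod_i\underline{X}_i=\bigcup_i\{i\}\times X_i$ carries the smallest topology containing all $\{i\}\times U$, $U$ open in $\underline{X}_i$; for partial $f_i:\subseteq\underline{X}_i\to\underline{Y}_i$, $\lceil f_i\rceil_{i\in I}(i,x)=(i,f_i(x))$ (defined iff $x\in\operatorname{dom}f_i$), and $\lceil P_i\rceil_{i\in I}=\{\lceil f_i\rceil_{i\in I}\mid f_i\in P_i\text{ for all }i\in I\}$. *)

(* Defs.v *)
From HB Require Import structures.
From mathcomp Require Import all_boot.
From mathcomp Require Import all_classical.
From mathcomp Require wochoice.
From mathcomp Require Import topology_structure subspace_topology.
From mathcomp Require Import initial_topology subtype_topology sigT_topology.

Set Implicit Arguments.
Unset Strict Implicit.
Unset Printing Implicit Defensive.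

Local Open Scope classical_set_scope.

(** Ordinals.  [osup A f] denotes the ordinal sup_(a : A) (f a + 1), so that
    every ordinal of the universe of [A] has a code; [ole] compares the
    denotations and [Ord] is the quotient by mutual [ole].

    [Ord] lives in a larger universe than the spaces.  Collections of ordinals
    are therefore plain predicates [Ord -> Prop], not MathComp [set]s. *)

Inductive otree : Type := osup (A : Type) (f : A -> otree).

Fixpoint ole (s t : otree) {struct s} : Prop :=
  let: osup A f := s in
  forall a : A, let: osup B g := t in exists b : B, ole (f a) (g b).

Definition oeqv (t : otree) : otree -> Prop := fun s => ole s t /\ ole t s.

Definition Ord : Type := {c : otree -> Prop | exists t, c = oeqv t}.

Definition oclass (t : otree) : Ord := exist _ (oeqv t) (ex_intro _ t erefl).

Definition orepr (a : Ord) : otree := proj1_sig (cid (proj2_sig a)).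

Definition ord_le (a b : Ord) : Prop := ole (orepr a) (orepr b).

Definition ord_lt (a b : Ord) : Prop := ~ ord_le b a.

Definition ozero : Ord := oclass (@osup False (fun x => match x with end)).

Definition osucc (a : Ord) : Ord := oclass (@osup unit (fun=> orepr a)).

Definition ord_limit (a : Ord) : Prop := a <> ozero /\ forall b, a <> osucc b.

Lemma ole_refl t : ole t t.
Proof. by elim: t => A f IH /= a; exists a. Qed.

Lemma ole_trans t s u : ole s t -> ole t u -> ole s u.
Proof.
elim: s t u => A f IH [B g] [C h] /= fg gh a.
have [b fab] := fg a; have [c gbc] := gh b.
by exists c; exact: IH fab gbc.
Qed.

Lemma not_ole s t :
  ~ ole s t <-> let: osup A f := s in exists a, ole t (f a).
Proof.
elim: t s => B g IH [A f]; split => /=.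
  move=> /existsNP[a /forallNP nab]; exists a => b.
  case E : (f a) => [C h].
  by have /IH := nab b; rewrite E.
move=> [a ta] fg; have [b] := fg a; apply/IH.
by have := ta b; case: (f a).
Qed.

Lemma ole_child A (f : A -> otree) a : ole (f a) (osup f).
Proof.
have [t tE] : exists t, t = f a by exists (f a).
rewrite -tE; elim: t A f a tE => B g IH A f a tE /= b.
by exists a; rewrite -tE; exact: IH.
Qed.

Lemma ole_total s t : ole s t \/ ole t s.
Proof.
have [|/not_ole] := pselect (ole s t); first by left.
case: s => A f [a tfa]; right; apply: ole_trans tfa _; exact: ole_child.
Qed.

Lemma oreprK t : oeqv t (orepr (oclass t)).
Proof.
rewrite /orepr; case: cid => u /= tu.
by rewrite tu; split; exact: ole_refl.
Qed.

Lemma oclassK a : oclass (orepr a) = a.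
Proof.
case: a => c ce; rewrite /orepr /oclass; case: cid => u /= cu.
by apply: eq_exist; rewrite cu.
Qed.

Lemma oclass_eq s t : ole s t -> ole t s -> oclass s = oclass t.
Proof.
move=> st ts; apply: eq_exist; apply/funext => u; apply/propext.
split=> -[us su]; split; try exact: ole_trans us _; exact: ole_trans _ su.
Qed.

Lemma ord_le_class s t : ord_le (oclass s) (oclass t) <-> ole s t.
Proof.
rewrite /ord_le; have [rs sr] := oreprK s; have [rt tr] := oreprK t; split=> h.
  exact: ole_trans (ole_trans sr h) rt.
exact: ole_trans (ole_trans rs h) tr.
Qed.

Lemma ord_le_refl a : ord_le a a. Proof. exact: ole_refl. Qed.

Lemma ord_le_trans b a c : ord_le a b -> ord_le b c -> ord_le a c.
Proof. exact: ole_trans. Qed.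

Lemma ord_le_anti a b : ord_le a b -> ord_le b a -> a = b.
Proof. by move=> ab ba; rewrite -[a]oclassK -[b]oclassK; exact: oclass_eq. Qed.

Lemma ord_le_total a b : ord_le a b \/ ord_le b a.
Proof. exact: ole_total. Qed.

Lemma ord_ltW a b : ord_lt a b -> ord_le a b.
Proof. by move=> ab; case: (ord_le_total a b). Qed.

Lemma ord_le_lt_trans b a c : ord_le a b -> ord_lt b c -> ord_lt a c.
Proof. by move=> ab bc ca; apply: bc; exact: ord_le_trans ca ab. Qed.

Lemma ord_lt_class_osup s A (f : A -> otree) :
  ord_lt (oclass s) (oclass (osup f)) <-> exists a, ole s (f a).
Proof. by rewrite /ord_lt -(not_ole (osup f)) ord_le_class. Qed.

Lemma ord_lt_wf : well_founded ord_lt.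
Proof.
suff acc t : forall a, ord_le a (oclass t) -> Acc ord_lt a.
  by move=> a; apply: (acc (orepr a)); rewrite oclassK; exact: ord_le_refl.
elim: t => A f IH a af; constructor => b ba.
have : ord_lt b (oclass (osup f)) by move=> fb; apply: ba; exact: ord_le_trans fb.
rewrite -[b]oclassK => /ord_lt_class_osup[x bfx].
by apply: (IH x); apply/ord_le_class.
Qed.

Lemma ord_le0 a : ord_le ozero a.
Proof. by rewrite -[a]oclassK; apply/ord_le_class. Qed.

Lemma ord_lt_succ a b : ord_lt a (osucc b) <-> ord_le a b.
Proof.
rewrite -{1}[a]oclassK; split=> [/ord_lt_class_osup[]//|ab].
by apply/ord_lt_class_osup; exists tt.
Qed.

Lemma ord_small_ub (A : Type) (g : A -> Ord) :
  exists b, forall c, ord_lt c b <-> exists a, ord_le c (g a).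
Proof.
exists (oclass (osup (fun a => orepr (g a)))) => c.
by rewrite -{1}[c]oclassK; exact: ord_lt_class_osup.
Qed.

Lemma ord_small_segment (a : Ord) :
  exists (A : Type) (g : A -> Ord), forall c, ord_lt c a <-> exists x, ord_le c (g x).
Proof.
case E : (orepr a) => [A f]; exists A, (fun x => oclass (f x)) => c.
rewrite -{1}[a]oclassK E -[c]oclassK; split=> [/ord_lt_class_osup[x h]|[x h]].
  by exists x; exact/ord_le_class.
by apply/ord_lt_class_osup; exists x; exact/ord_le_class.
Qed.

(** Extended ordinals: [None] is the value greater than all ordinals. *)

Definition EOrd : Type := option Ord.

Definition eord_le (x y : EOrd) : Prop :=
  match x, y with
  | _, None => True
  | None, Some _ => False
  | Some a, Some b => ord_le a b
  end.

Definition eord_is_min (S : EOrd -> Prop) (x : EOrd) : Prop :=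
  S x /\ forall y, S y -> eord_le x y.

(* The minimum of the empty collection is [None]. *)
Definition eord_min (S : EOrd -> Prop) : EOrd :=
  match pselect (exists x, eord_is_min S x) with
  | left h => proj1_sig (cid h)
  | right _ => None
  end.

Definition eord_sup (S : EOrd -> Prop) : EOrd :=
  eord_min (fun u => forall x, S x -> eord_le x u).

Lemma eord_minP (S : EOrd -> Prop) :
  (exists x, S x) -> eord_is_min S (eord_min S).
Proof.
move=> [x Sx]; rewrite /eord_min; case: pselect => [h|]; first by case: cid.
case; have [h|h] := pselect (exists a, S (Some a)); last first.
  exists None; case: x Sx => [a Sa|S0]; first by case: h; exists a.
  by split => // -[a Sa|//]; case: h; exists a.
have [a Sa] := h; elim/(well_founded_ind ord_lt_wf): a Sa => a IH Sa.
have [[b [ba Sb]]|nb] := pselect (exists b, ord_lt b a /\ S (Some b)).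
  exact: IH Sb.
exists (Some a); split=> // -[b Sb|//] /=.
by apply: contrapT => ab; apply: nb; exists b.
Qed.

Lemma eord_min_empty (S : EOrd -> Prop) : ~ (exists x, S x) -> eord_min S = None.
Proof.
move=> S0; rewrite /eord_min; case: pselect => // h;
by case: S0; have [x []] := h; exists x.
Qed.

(** Cardinals are initial ordinals. *)

Definition equinumerous (T : Type) (a : Ord) : Prop :=
  exists g : T -> Ord, injective g /\ forall b, ord_lt b a <-> exists t, g t = b.

Definition ecard (T : Type) : EOrd :=
  eord_min (fun x => exists a, x = Some a /\ equinumerous T a).

Lemma equinumerous_exists (T : Type) : exists a, equinumerous T a.
Proof.
have [R woR] := wochoice.well_ordering_principle {classic T}.
pose lt (s t : T) := ~~ R t s.
have minR (P : T -> Prop) : (exists t, P t) -> exists m, [/\ P m,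
    forall t, P t -> R m t & forall n, P n -> (forall t, P t -> R n t) -> n = m].
  move=> [t Pt]; have [|m [[Pm mP] uniq]] := woR (fun x : T => `[< P x >]).
    by exists t; exact/asboolP.
  exists m; split; first exact/asboolP.
    by move=> u Pu; apply: mP; exact/asboolP.
  move=> n Pn nP; apply/esym/uniq; split; first exact/asboolP.
  by move=> x /asboolP; exact: nP.
have wf : well_founded lt.
  move=> t; apply: contrapT => nt.
  have [m [nm mP _]] := minR (fun x => ~ Acc lt x) (ex_intro _ t nt).
  apply: nm; constructor => s sm; apply: contrapT => ns.
  by move: sm; rewrite /lt mP.
have refl t : R t t.
  by have [m [-> + _]] := minR (fun x => x = t) (ex_intro _ t erefl); exact.
have tot s t : s <> t -> lt s t \/ lt t s.
  move=> st; rewrite /lt; case Est : (R s t); case Ets : (R t s);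
    [|by left|by right|by left].
  have [m [_ _ u]] := minR (fun x => x = s \/ x = t) (ex_intro _ s (or_introl erefl)).
  have sm : s = m by apply: u => [|x [] ->//]; left.
  have tm : t = m by apply: u => [|x [] ->//]; right.
  by case: st; rewrite sm tm.
pose G := Fix wf (fun=> otree)
  (fun t rec => @osup {s | lt s t} (fun p => rec (proj1_sig p) (proj2_sig p))).
have GE t : G t = @osup {s | lt s t} (fun p => G (proj1_sig p)).
  rewrite /G Fix_eq// => x f g fg; congr osup; apply/funext => p; exact: fg.
have Glt s t : lt s t -> ord_lt (oclass (G s)) (oclass (G t)).
  move=> st; rewrite (GE t); apply/ord_lt_class_osup.
  by exists (exist _ s st); exact: ole_refl.
exists (oclass (osup G)), (fun t => oclass (G t)); split.
  move=> s t st; apply: contrapT => /tot[] /Glt; rewrite st; apply; exact: ord_le_refl.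
move=> b; split=> [|[t <-]]; last first.
  by apply/ord_lt_class_osup; exists t; exact: ole_refl.
rewrite -{1}[b]oclassK => /ord_lt_class_osup[t] /ord_le_class; rewrite oclassK.
elim/(well_founded_ind wf): t => t IH bt.
have [tb|] := pselect (ord_le (oclass (G t)) b).
  by exists t; exact: ord_le_anti.
rewrite -/(ord_lt _ _) (GE t) -{1}[b]oclassK => /ord_lt_class_osup[[s st] bs].
by apply: (IH s st); rewrite -[b]oclassK; exact/ord_le_class.
Qed.

Lemma ecard_is_min (T : Type) :
  eord_is_min (fun x => exists a, x = Some a /\ equinumerous T a) (ecard T).
Proof.
by apply: eord_minP; have [a Ta] := equinumerous_exists T; exists (Some a), a.
Qed.

Variant ord_case (a : Ord) : Type :=
  | OrdZero of a = ozero
  | OrdSucc (b : Ord) of a = osucc b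
  | OrdLimit of ord_limit a.

Definition ord_caseP (a : Ord) : ord_case a :=
  match pselect (a = ozero) with
  | left e => OrdZero e
  | right a0 =>
    match pselect (exists b, a = osucc b) with
    | left e => OrdSucc (proj2_sig (cid e))
    | right aS => OrdLimit (conj a0 (fun b e => aS (ex_intro _ b e)))
    end
  end.

Lemma osucc_lt (a b : Ord) : a = osucc b -> ord_lt b a.
Proof. by move=> ->; exact/(iffRL (ord_lt_succ _ _))/ord_le_refl. Qed.

(* The sequence L_0 = X, L_(a+1) = step L_a, L_c = lim (\bigcap_(a < c) L_a). *)
Definition levels (X : Type) (step lim : set X -> set X) : Ord -> set X :=
  Fix ord_lt_wf (fun=> set X) (fun a rec =>
    match ord_caseP a with
    | OrdZero _ => setT
    | OrdSucc b e => step (rec b (osucc_lt e))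
    | OrdLimit _ => lim [set x | forall b (ba : ord_lt b a), rec b ba x]
    end).

Lemma osucc_inj : injective osucc.
Proof.
move=> a b ab; apply: ord_le_anti.
  exact/ord_lt_succ/osucc_lt/esym.
exact/ord_lt_succ/osucc_lt.
Qed.

Lemma osucc_neq0 a : osucc a <> ozero.
Proof.
by move=> a0; have := @osucc_lt _ a erefl; rewrite a0; apply; exact: ord_le0.
Qed.

Section levels_lemmas.
Variables (X : Type) (step lim : set X -> set X).
Let L := levels step lim.

Let levelsE a : L a =
  match ord_caseP a with
  | OrdZero _ => setT
  | OrdSucc b e => step (L b)
  | OrdLimit _ => lim [set x | forall b (ba : ord_lt b a), L b x]
  end.
Proof.
rewrite /L /levels Fix_eq// => {}a f g fg; case: ord_caseP => // [b e|_].
  by rewrite fg.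
congr lim; apply/seteqP; split=> x h b ba; have := h b ba; by rewrite fg.
Qed.

Lemma levels0 : L ozero = setT.
Proof.
rewrite levelsE; case: ord_caseP => //[b /esym/osucc_neq0//|[]//].
Qed.

Lemma levelsS a : L (osucc a) = step (L a).
Proof.
rewrite levelsE; case: ord_caseP => [/osucc_neq0//|b /osucc_inj<-//|[_]].
by move=> /(_ a).
Qed.

Lemma levels_lim c : ord_limit c ->
  L c = lim [set x | forall a, ord_lt a c -> L a x].
Proof.
by move=> [c0 cS]; rewrite levelsE; case: ord_caseP => // b /cS.
Qed.

End levels_lemmas.

Section numbers.
Variables (X Y : topologicalType) (f : X -> Y).

Definition discontinuities (A : set X) : set X :=
  [set x | A x /\ ~ (f @ within A (nbhs x) --> f x)].

Definition level1 : Ord -> set X := levels discontinuities id.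

Definition level2 : Ord -> set X :=
  levels (fun A => closure (discontinuities A)) closure.

Definition Lev1 : EOrd :=
  eord_min (fun x => exists a, x = Some a /\ level1 a = set0).

Definition Lev2 : EOrd :=
  eord_min (fun x => exists a, x = Some a /\ level2 a = set0).

Definition partition_for (p : set (set X)) : Prop :=
  partition p id [set: X] /\ forall U, p U -> {within U, continuous f}.

Definition bas : EOrd :=
  eord_min (fun x => exists p, partition_for p /\ x = ecard p).

End numbers.

Variant num_kind := NumLev1 | NumLev2 | NumBas.

Definition num_fun (k : num_kind) (X Y : topologicalType) (f : X -> Y) : EOrd :=
  match k with
  | NumLev1 => Lev1 f
  | NumLev2 => Lev2 f
  | NumBas => bas f
  end.

(** Partial functions and problems.  The domain, coerced to a type, carries the
    subspace topology of [subtype_topology]. *)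

Record pfun (X Y : Type) := PFun {
  pdom : set X;
  pval : pdom -> Y
}.

Definition problem (X Y : Type) : Type := set (pfun X Y).

Definition num_problem (k : num_kind) (X Y : topologicalType)
    (P : problem X Y) : EOrd :=
  eord_min (fun x => exists f, P f /\ x = num_fun k (@pval X Y f)).

Section coproduct.
Variables (I : choiceType) (X Y : I -> topologicalType).

Definition coprod_dom (f : forall i, pfun (X i) (Y i)) : set {i & X i} :=
  [set z | pdom (f (projT1 z)) (projT2 z)].

Definition coprod_pfun (f : forall i, pfun (X i) (Y i)) :
    pfun {i & X i} {i & Y i} :=
  @PFun _ _ (coprod_dom f) (fun z : coprod_dom f =>
    existT Y (projT1 (val z))
      (pval (exist _ (projT2 (val z)) (mem_set (set_mem (valP z)))))).

Definition coprod_problem (P : forall i, problem (X i) (Y i)) :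
    problem {i & X i} {i & Y i} :=
  [set coprod_pfun f | f in [set f | forall i, P i (f i)]].

End coproduct.

(* Main.v *)
(** Each inclusion of a summand into the coproduct is a continuous open
    injection, so it pulls back discontinuity sets, closures and hence all
    levels; and the inclusions are jointly surjective.  Thus the level of index
    [a] of a coproduct is empty iff those of all summands are.  A partition for
    a function into at most [a] pieces amounts to a colouring of its domain by
    ordinals below [a] with continuous restrictions to the colour classes, and
    colourings of the summands glue.  So [num <= a] holds for a coproduct of
    functions iff it holds for every summand, and the axiom of choice transfers
    this to problems. *)

Require Import Defs.
From mathcomp Require Import all_boot all_classical.
From mathcomp Require Import topology_structure sigT_topology.
From mathcomp Require Import subspace_topology subtype_topology.

Set Implicit Arguments.
Unset Strict Implicit.
Unset Printing Implicit Defensive.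

Local Open Scope classical_set_scope.

(** * Extended ordinals and their ordinal upper bounds *)

Lemma ord_lt_le_trans b a c : ord_lt a b -> ord_le b c -> ord_lt a c.
Proof. by move=> ab bc ca; apply: ab; exact: ord_le_trans ca. Qed.

Lemma eord_le_trans y x z : eord_le x y -> eord_le y z -> eord_le x z.
Proof. by case: x y z => [a|] [b|] [c|] //=; exact: ord_le_trans. Qed.

(** Two ordinals with the same upper bounds bound each other, and [None] is the only value without
    an ordinal bound. Equalities of numbers thus reduce to comparisons with a fixed [Some a]. *)
Lemma eord_eq_le x y :
  (forall a, eord_le x (Some a) <-> eord_le y (Some a)) -> x = y.
Proof.
case: x y => [a|] [b|] //= xy.
- congr Some; apply: ord_le_anti.
    by apply/(xy b); exact: ord_le_refl.
  by apply/(xy a); exact: ord_le_refl.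
- by have [/(_ (ord_le_refl a))] := xy a.
- by have [_ /(_ (ord_le_refl b))] := xy b.
Qed.

(** A minimum over a nonempty collection is attained; over the empty one it is [None], and both
    sides fail. *)
Lemma eord_min_le (S : EOrd -> Prop) a :
  eord_le (eord_min S) (Some a) <-> exists x, S x /\ eord_le x (Some a).
Proof.
split=> [|[x [Sx xa]]]; last first.
  have [_ minS] := eord_minP (ex_intro _ x Sx).
  exact: eord_le_trans (minS x Sx) xa.
have [/eord_minP[Sm _] ma|/eord_min_empty->//] := pselect (exists x, S x).
by exists (eord_min S).
Qed.

Lemma eord_sup_le (S : EOrd -> Prop) a :
  eord_le (eord_sup S) (Some a) <-> forall x, S x -> eord_le x (Some a).
Proof.
rewrite eord_min_le; split=> [[u [Su ua]] x Sx|Sa].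
  exact: eord_le_trans (Su x Sx) ua.
by exists (Some a); split => //; exact: ord_le_refl.
Qed.

(** An injection into the ordinals below [a] well-orders [T]. Its image may have gaps; passing to
    ranks closes them and never raises a value, so the order type of [T] is at most [a]. *)
Lemma ecard_le_inj (T : Type) a : eord_le (ecard T) (Some a) <->
  exists g : T -> Ord, injective g /\ forall t, ord_lt (g t) a.
Proof.
rewrite eord_min_le; split=> [[_ [[b [-> [g [ginj gb]]]] ba]]|[g [ginj ga]]].
  exists g; split=> // t; apply: (@ord_lt_le_trans b) => //.
  by apply/gb; exists t.
pose lt (s t : T) := ord_lt (g s) (g t).
have wf : well_founded lt.
  move=> t; move E: (g t) => b.
  elim/(well_founded_ind ord_lt_wf): b t E => b IH t E.
  by constructor => s; rewrite /lt E => sb; exact: IH sb s erefl.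
pose G := Fix wf (fun=> otree)
  (fun t rec => @osup {s | lt s t} (fun p => rec (proj1_sig p) (proj2_sig p))).
have GE t : G t = @osup {s | lt s t} (fun p => G (proj1_sig p)).
  rewrite /G Fix_eq// => x f h fh; congr osup; apply/funext => p; exact: fh.
have Glt s t : lt s t -> ord_lt (oclass (G s)) (oclass (G t)).
  move=> st; rewrite (GE t); apply/ord_lt_class_osup.
  by exists (exist _ s st); exact: ole_refl.
(* Otherwise [g t <= G s <= g s < g t] for some [s] before [t]. *)
have Gle t : ord_le (oclass (G t)) (g t).
  elim/(well_founded_ind wf): t => t IH; apply: contrapT => tG.
  have : ord_lt (g t) (oclass (G t)) by [].
  rewrite (GE t) -[g t]oclassK => /ord_lt_class_osup[[s st] /= ts].
  apply: (ord_le_lt_trans (IH s st) st).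
  by rewrite -[g t]oclassK; exact/ord_le_class.
exists (Some (oclass (osup G))); split; last first.
  apply: contrapT => aG; have : ord_lt a (oclass (osup G)) by [].
  rewrite -[a]oclassK => /ord_lt_class_osup[t /ord_le_class].
  rewrite oclassK; exact: (ord_le_lt_trans (Gle t) (ga t)).
exists (oclass (osup G)); split=> //; exists (fun t => oclass (G t)); split.
  move=> s t st; apply: ginj; apply: ord_le_anti; apply: contrapT => /Glt;
  by rewrite st; apply; exact: ord_le_refl.
move=> b; split=> [|[t <-]]; last first.
  by apply/ord_lt_class_osup; exists t; exact: ole_refl.
(* Ranks leave no gap: descending from some [t] with [b] at most its rank stops at an element of
   rank exactly [b]. *)
rewrite -{1}[b]oclassK => /ord_lt_class_osup[t] /ord_le_class; rewrite oclassK.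
elim/(well_founded_ind wf): t => t IH bt.
have [tb|] := pselect (ord_le (oclass (G t)) b).
  by exists t; exact: ord_le_anti.
rewrite -/(ord_lt _ _) (GE t) -{1}[b]oclassK => /ord_lt_class_osup[[s st] bs].
by apply: (IH s st); rewrite -[b]oclassK; exact/ord_le_class.
Qed.

(** * Levels and their emptiness *)

Lemma levels_eq0_le (X : Type) (step lim : set X -> set X) a b :
  step set0 = set0 -> lim set0 = set0 -> ord_le a b ->
  levels step lim a = set0 -> levels step lim b = set0.
Proof.
move=> step0 lim0 ab La; elim/(well_founded_ind ord_lt_wf): b ab => b IH ab.
have [<-//|ba] := pselect (a = b).
have {}ba : ord_lt a b by move=> ba'; apply: ba; exact: ord_le_anti.
case: (ord_caseP b) => [b0|c bc|blim].
- by case: ba; rewrite b0; exact: ord_le0.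
- rewrite bc levelsS IH//; first exact: osucc_lt.
  by apply/ord_lt_succ; rewrite -bc.
- rewrite levels_lim// (_ : [set _ | _] = set0)//.
  by rewrite -subset0 => x /(_ a ba); rewrite La.
Qed.

Lemma eord_min_levels_le (X : Type) (step lim : set X -> set X) a :
  step set0 = set0 -> lim set0 = set0 ->
  eord_le (eord_min (fun x => exists b, x = Some b /\
    levels step lim b = set0)) (Some a) <-> levels step lim a = set0.
Proof.
move=> step0 lim0; rewrite eord_min_le; split=> [[_ [[b [-> Lb]] ba]]|La].
  exact: levels_eq0_le Lb.
by exists (Some a); split; [exists a|exact: ord_le_refl].
Qed.

(** Preimages commute with intersections, so transfinite induction needs only the compatibility with
    [step] and [lim]. *)
Lemma levels_preimage (X Z : Type) (e : X -> Z) step lim step' lim' :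
  (forall A, e @^-1` step A = step' (e @^-1` A)) ->
  (forall A, e @^-1` lim A = lim' (e @^-1` A)) ->
  forall a, e @^-1` levels step lim a = levels step' lim' a.
Proof.
move=> stepE limE; elim/(well_founded_ind ord_lt_wf) => a IH.
case: (ord_caseP a) => [->|b ab|alim].
- by rewrite !levels0 preimage_setT.
- by rewrite ab !levelsS stepE IH//; exact: osucc_lt.
- rewrite !levels_lim// limE; congr lim'.
  by apply/seteqP; split=> x Lx b ba; have := Lx b ba; rewrite -IH.
Qed.

Lemma discontinuities0 (X Y : topologicalType) (f : X -> Y) :
  discontinuities f set0 = set0.
Proof. by rewrite -subset0 => x []. Qed.

Lemma Lev1_le (X Y : topologicalType) (f : X -> Y) a :
  eord_le (Lev1 f) (Some a) <-> level1 f a = set0.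
Proof. by apply: eord_min_levels_le => //; exact: discontinuities0. Qed.

Lemma Lev2_le (X Y : topologicalType) (f : X -> Y) a :
  eord_le (Lev2 f) (Some a) <-> level2 f a = set0.
Proof.
by apply: eord_min_levels_le; rewrite ?discontinuities0 closure0.
Qed.

Lemma within_continuous_discontinuities (X Y : topologicalType) (f : X -> Y)
    (A : set X) : {within A, continuous f} <-> discontinuities f A = set0.
Proof.
split=> [fA|fA].
  rewrite -subset0 => x [Ax]; apply; have := fA x.
  by rewrite /continuous_at; case: _ / (@nbhs_subspaceP _ A x).
move=> x; rewrite /continuous_at; case: _ / (@nbhs_subspaceP _ A x) => Ax; last first.
  (* Off [A] the neighbourhood filter of [subspace A] is principal, so continuity there is
     automatic. *)
  by move=> U /nbhs_singleton Ux _ ->.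
by apply: contrapT => fx; suff : set0 x by []; rewrite -fA.
Qed.

(** The colours are bounded by [a] but need not exhaust it, so colour classes may be empty; this
    makes colourings easier to restrict and glue than partitions. *)
Lemma bas_le (X Y : topologicalType) (f : X -> Y) a :
  eord_le (bas f) (Some a) <-> exists c : X -> Ord, (forall x, ord_lt (c x) a) /\
    forall b, discontinuities f [set x | c x = b] = set0.
Proof.
rewrite eord_min_le; split=> [[_ [[p [[[pT ptriv p0] fp] ->]]]]|[c [ca fc]]].
  move=> /ecard_le_inj[g [ginj ga]].
  have blockP x : exists U : p, (val U) x.
    have : cover p id x by rewrite pT.
    by move=> [U pU Ux]; exists (exist _ U (mem_set pU)).
  have [B BP] := choice blockP.
  exists (g \o B); split=> [x|b]; first exact: ga.
  rewrite -subset0 => x [<-{b}]; apply.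
  (* Blocks are numbered injectively, so the colour class of [x] is exactly its block. *)
  suff -> : [set y | g (B y) = g (B x)] = val (B x).
    have /within_continuous_discontinuities fB := fp _ (set_mem (valP (B x))).
    by apply: contrapT => fx; suff : set0 x by []; rewrite -fB; split.
  apply/seteqP; split=> y /= => [/ginj<-|Bxy]; first exact: BP.
  congr g; apply: val_inj; apply: ptriv; try exact: set_mem (valP _).
  by exists y; split.
(* Taking only classes of actual points keeps the blocks nonempty. *)
pose p := [set [set y | c y = c x] | x in [set: X]].
exists (ecard p); split.
  exists p; split=> //; split; last first.
    by move=> _ [x _ <-]; exact/within_continuous_discontinuities.
  split.
  - apply/seteqP; split=> // x _; exists [set y | c y = c x] => //; by exists x.
  - by move=> _ _ [x _ <-] [y _ <-] [z [/= -> ->]].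
  - by move=> _ [x _ <-]; exists x.
(* The colour of a representative determines its block, which gives an injection of [p] into the
   ordinals below [a]. *)
have reprP (U : p) : exists x, val U = [set y | c y = c x].
  by have [x _ <-] := set_mem (valP U); exists x.
have [r rP] := choice reprP.
apply/ecard_le_inj; exists (c \o r); split=> [U V /= UV|U]; last exact: ca.
by apply: val_inj; rewrite !rP UV.
Qed.

(** * Pulling levels back along continuous open maps *)

Section open_map.
Variables (X Z : topologicalType) (e : X -> Z).
Hypothesis nbhs_e : forall x A, nbhs (e x) A <-> nbhs x (e @^-1` A).

Lemma closure_preimage_open_map A : e @^-1` closure A = closure (e @^-1` A).
Proof.
apply/seteqP; split=> x Ax B xB; last first.
  by have /nbhs_e /Ax[y [Ay By]] := xB; exists (e y).
(* Openness makes the image of [B] a neighbourhood of [e x], so it meets [A]. *)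
have /Ax[z [Az [y By yE]]] : nbhs (e x) (e @` B).
  by apply/nbhs_e; apply: filterS xB; exact: preimage_image.
by exists y; split=> //; rewrite /preimage/= yE.
Qed.

Variables (Y W : topologicalType) (e' : Y -> W) (f : X -> Y) (g : Z -> W).
Hypothesis nbhs_e' : forall y A, nbhs (e' y) A <-> nbhs y (e' @^-1` A).
Hypothesis e'_inj : injective e'.
Hypothesis ge : forall x, g (e x) = e' (f x).

Lemma discontinuities_preimage A :
  e @^-1` discontinuities g A = discontinuities f (e @^-1` A).
Proof.
suff cvgE x : (g @ within A (nbhs (e x)) --> g (e x)) <->
    (f @ within (e @^-1` A) (nbhs x) --> f x).
  by apply/seteqP; split=> x [Ax gx]; split=> // /cvgE.
split=> h U.
  (* The image of [U] under the open map [e'] is a neighbourhood to test [g] on; injectivity of [e']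
     then returns from the image to [U]. *)
  move=> fU; have /h : nbhs (g (e x)) (e' @` U).
    by rewrite ge; apply/nbhs_e'; apply: filterS fU; exact: preimage_image.
  rewrite /= !nbhs_simpl /within /= => /nbhs_e; apply: filterS => y yU Ay.
  by have [u Uu] := yU Ay; rewrite ge => /e'_inj <-.
rewrite ge => /nbhs_e' /h; rewrite /= !nbhs_simpl /within /= => xU.
by apply/nbhs_e; apply: filterS xU => y /= yU Ay; rewrite ge; exact: yU.
Qed.

Lemma level1_preimage a : e @^-1` level1 g a = level1 f a.
Proof. by apply: levels_preimage => //; exact: discontinuities_preimage. Qed.

Lemma level2_preimage a : e @^-1` level2 g a = level2 f a.
Proof.
apply: levels_preimage => A; rewrite closure_preimage_open_map//.
by rewrite discontinuities_preimage.
Qed.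

End open_map.

(** * Coproducts of partial functions *)

Lemma nbhs_subtypeE (X : topologicalType) (A : set X) (x : A) (U : set A) :
  nbhs x U <-> exists2 V, nbhs (val x) V & forall y : A, V (val y) -> U y.
Proof.
split=> [[_ [[V oV <-] Vx VU]]|[V]].
  by exists V; [exact: open_nbhs_nbhs|move=> y Vy; exact: VU].
rewrite nbhsE => -[V' [oV' V'x V'V]] VU.
exists (val @^-1` V'); split=> //; first by exists V'.
by move=> y /V'V/VU.
Qed.

Lemma nbhs_existT (I : choiceType) (X : I -> topologicalType) i (x : X i) A :
  nbhs (existT X i x) A <-> nbhs x (existT X i @^-1` A).
Proof. by []. Qed.

Section coproduct.
Variables (I : choiceType) (X Y : I -> topologicalType).
Variable f : forall i, pfun (X i) (Y i).

(** The detour through [set_mem] and [mem_set] retypes the membership proof: the two domain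
    conditions are convertible as propositions. *)
Definition coprod_inj i (x : pdom (f i)) : coprod_dom f :=
  exist _ (existT X i (val x)) (mem_set (set_mem (valP x))).

Lemma coprod_inj_surj (z : coprod_dom f) : exists i x, z = @coprod_inj i x.
Proof.
case: z => -[i x] xf; exists i, (exist _ x (mem_set (set_mem xf))).
exact: val_inj.
Qed.

Lemma nbhs_coprod_inj i (x : pdom (f i)) A :
  nbhs (coprod_inj x) A <-> nbhs x (@coprod_inj i @^-1` A).
Proof.
rewrite !nbhs_subtypeE; split=> [[V xV VA]|[V xV VA]].
  by exists (existT X i @^-1` V) => // y; exact: (VA (coprod_inj y)).
exists (existT X i @` V); first exact: existT_nbhs.
move=> z; have [j [y ->]] := coprod_inj_surj z.
(* Equal tagged points have equal indices; only after identifying these can the components be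
   compared. *)
move=> [v Vv] /= vy; have ij := projT1_eq vy; simpl in ij; subst j.
by apply: (VA y); move: Vv; rewrite (existT_inj2 vy).
Qed.

Lemma coprod_pfunE i (x : pdom (f i)) :
  pval (p := coprod_pfun f) (coprod_inj x) = existT Y i (pval x).
Proof. by rewrite /=; congr existT; congr pval; exact: val_inj. Qed.

Lemma coprod_set0 (A : set (coprod_dom f)) :
  A = set0 <-> forall i, @coprod_inj i @^-1` A = set0.
Proof.
split=> [-> i|A0]; first exact: preimage_set0.
rewrite -subset0 => z; have [i [x ->]] := coprod_inj_surj z => Ax.
by suff : set0 x by []; rewrite -(A0 i).
Qed.

Let existTI i : injective (existT Y i).
Proof. by move=> y y' yy'; exact: existT_inj2 yy'. Qed.

Lemma num_fun_coprod k a :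
  eord_le (num_fun k (@pval _ _ (coprod_pfun f))) (Some a) <->
  forall i, eord_le (num_fun k (@pval _ _ (f i))) (Some a).
Proof.
have discE i A := discontinuities_preimage (@nbhs_coprod_inj i)
  (@nbhs_existT _ _ i) (@existTI i) (@coprod_pfunE i) A.
case: k => /=.
- rewrite Lev1_le coprod_set0; split=> h i; have := h i; rewrite ?Lev1_le;
  by rewrite (level1_preimage (@nbhs_coprod_inj i)
    (@nbhs_existT _ _ i) (@existTI i) (@coprod_pfunE i)).
- rewrite Lev2_le coprod_set0; split=> h i; have := h i; rewrite ?Lev2_le;
  by rewrite (level2_preimage (@nbhs_coprod_inj i)
    (@nbhs_existT _ _ i) (@existTI i) (@coprod_pfunE i)).
- rewrite bas_le; split=> [[c [ca fc]] i|].
    rewrite bas_le; exists (c \o @coprod_inj i); split=> [x|b]; first exact: ca.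
    by have /coprod_set0/(_ i) := fc b; rewrite discE.
  move=> h; have {}h i := iffLR (bas_le _ _) (h i).
  pose C i := proj1_sig (cid (h i)).
  have CP i := proj2_sig (cid (h i)).
  (* Each point takes its colour from its own summand. Summands may share colours, since
     discontinuities are tested on each summand separately. *)
  exists (fun z : coprod_dom f =>
    C (projT1 (val z)) (exist _ (projT2 (val z)) (mem_set (set_mem (valP z))))).
  split=> [z|b]; first exact: (CP _).1.
  apply/coprod_set0 => i; rewrite discE -((CP i).2 b); congr discontinuities.
  apply/seteqP; split=> x /= <-; rewrite /C; congr (proj1_sig _ _);
  exact: val_inj.
Qed.

End coproduct.

Lemma num_problem_le k (X Y : topologicalType) (P : problem X Y) a :
  eord_le (num_problem k P) (Some a) <->
  exists f, P f /\ eord_le (num_fun k (@pval X Y f)) (Some a).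
Proof.
rewrite eord_min_le; split=> [[_ [[f [Pf ->]] fa]]|[f [Pf fa]]].
  by exists f.
by exists (num_fun k (@pval X Y f)); split=> //; exists f.
Qed.

Theorem theorem5p16 (k : num_kind) (I : choiceType)
    (X Y : I -> topologicalType) (P : forall i : I, problem (X i) (Y i)) :
  num_problem k (coprod_problem P) =
    eord_sup (fun x => exists i : I, x = num_problem k (P i)).
Proof.
(* If some [P i] is empty, neither side has an ordinal bound, so this case needs no separate
   treatment. *)
apply: eord_eq_le => a; rewrite num_problem_le eord_sup_le; split.
  move=> [_ [[f Pf <-] /num_fun_coprod fa]] _ [i ->].
  by apply/num_problem_le; exists (f i).
move=> Pa.
(* The minimum for [P i] is attained, so the bound [a] is met by an actual member, and one is chosen
   for every index. *)
have Pf i : exists f, P i f /\ eord_le (num_fun k (@pval _ _ f)) (Some a).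
  by apply/num_problem_le; apply: Pa; exists i.
pose f i := proj1_sig (cid (Pf i)).
have fP i := proj2_sig (cid (Pf i)).
exists (coprod_pfun f); split; first by exists f => // i; exact: (fP i).1.
by apply/num_fun_coprod => i; exact: (fP i).2.
Qed.
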